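(* Let $R$ be the finite bounded graded poset of rank $4$ with elements $\hat 0,x_1,x_2,x_3,y_1,y_2,y_3,y_4,z_1,z_2,z_3,z_4,z_5,\hat 1$ whose cover relations are exactly the following: $\hat 0\lessdot x_1,x_2,x_3$; $x_1\lessdot y_1,y_2,y_3$; $x_2\lessdot y_1,y_3,y_4$; $x_3\lessdot y_2,y_3,y_4$; $y_1\lessdot z_1,z_2,z_3$; $y_2\lessdot z_1,z_3,z_4$; $y_3\lessdot z_3,z_4,z_5$; $y_4\lessdot z_2,z_3,z_4$; and $z_i\lessdot\hat 1$ for $i=1,\dots,5$. Then $R$ is EL-shellable.
   Context: Write $s\lessdot t$ if $t$ covers $s$; the notation $x\lessdot a,b,c$ means that $x$ is covered by each of $a,b,c$. For a finite graded bounded poset $P$, let $\mathcal{E}(P)$ be the set of pairs $(s,t)$ with $s\lessdot t$. An edge labeling is a map $\lambda:\mathcal{E}(P)\to\Lambda$, where $\Lambda$ is a totally ordered set. A maximal chain $s=u_0\lessdot u_1\lessdot\cdots\lessdot u_k=t$ of the interval $[s,t]$ has label word $\lambda(u_0,u_1)\cdots\lambda(u_{k-1},u_k)$. The labeling $\lambda$ is an EL-labeling if for all $s\leqslant t$ in $P$ there is a unique maximal chain of $[s,t]$ whose label word is weakly increasing (as the rank increases), and this chain's label word is lexicographically minimal among the label words of all maximal chains of $[s,t]$. $P$ is EL-shellable if it admits an EL-labeling (for some totally ordered set $\Lambda$). *)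

(* Defs.v *)
From HB Require Import structures.
From mathcomp Require Import all_boot all_order.

Set Implicit Arguments.
Unset Strict Implicit.
Unset Printing Implicit Defensive.

Import Order.TTheory.
Local Open Scope order_scope.

Section ELShellability.
Context {d : Order.disp_t} {P : finTBPOrderType d}.
Implicit Types (s t u : P) (c : seq P).

Definition covered s t : bool := (s < t) && [forall u, ~~ (s < u < t)].

(* The chain s = u_0 <. u_1 <. ... <. u_k = t is encoded by the sequence
   c = [:: u_1; ...; u_k], without its first element. *)
Definition maximal_chain s t c : bool := path covered s c && (last s c == t).

(* Every maximal chain from \bot to \top has length n; in a finite bounded poset
   this says that P is graded of rank n. *)
Definition graded_of_rank (n : nat) : Prop :=
  forall c, maximal_chain \bot \top c -> size c = n.

Section Labeling.
Context {dL : Order.disp_t} {L : orderType dL} (lam : P -> P -> L).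

(* An edge labeling is represented by a function on all pairs; only its values
   on pairs (s, t) with covered s t are ever used below. *)
Definition label_word s c : seq L := pairmap lam s c.

Definition increasing_chain s t c : Prop :=
  maximal_chain s t c /\ sorted <=%O (label_word s c).

Definition EL_labeling : Prop :=
  forall s t, s <= t ->
    exists2 c, unique (increasing_chain s t) c &
      forall c', maximal_chain s t c' ->
        (label_word s c : seqlexi L) <= label_word s c'.

End Labeling.
End ELShellability.

Definition EL_shellable (d : Order.disp_t) (P : finTBPOrderType d) : Prop :=
  exists (dL : Order.disp_t) (L : orderType dL) (lam : P -> P -> L),
    EL_labeling lam.

Inductive R : Type :=
  | R0
  | x1 | x2 | x3
  | y1 | y2 | y3 | y4
  | z1 | z2 | z3 | z4 | z5
  | R1.

Definition R_enum : seq R :=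
  [:: R0; x1; x2; x3; y1; y2; y3; y4; z1; z2; z3; z4; z5; R1].

Definition R_code (r : R) : nat :=
  match r with
  | R0 => 0
  | x1 => 1 | x2 => 2 | x3 => 3
  | y1 => 4 | y2 => 5 | y3 => 6 | y4 => 7
  | z1 => 8 | z2 => 9 | z3 => 10 | z4 => 11 | z5 => 12
  | R1 => 13
  end.

Lemma R_codeK : cancel R_code (nth R0 R_enum).
Proof. by case. Qed.

HB.instance Definition _ := Countable.copy R (can_type R_codeK).

Lemma R_enumP : Finite.axiom R_enum.
Proof. by case. Qed.

HB.instance Definition _ := isFinite.Build R R_enumP.

Definition R_upper_covers (r : R) : seq R :=
  match r with
  | R0 => [:: x1; x2; x3]
  | x1 => [:: y1; y2; y3]
  | x2 => [:: y1; y3; y4]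
  | x3 => [:: y2; y3; y4]
  | y1 => [:: z1; z2; z3]
  | y2 => [:: z1; z3; z4]
  | y3 => [:: z3; z4; z5]
  | y4 => [:: z2; z3; z4]
  | z1 | z2 | z3 | z4 | z5 => [:: R1]
  | R1 => [::]
  end.

Definition R_edge : rel R := [rel s t | t \in R_upper_covers s].

Definition R_le : rel R := connect R_edge.

Definition R_rank (r : R) : nat :=
  match r with
  | R0 => 0
  | x1 | x2 | x3 => 1
  | y1 | y2 | y3 | y4 => 2
  | z1 | z2 | z3 | z4 | z5 => 3
  | R1 => 4
  end.

Lemma R_edge_rank s t : R_edge s t -> R_rank t = (R_rank s).+1.
Proof. by case: s; case: t. Qed.

Lemma R_path_rank s c :
  path R_edge s c -> R_rank (last s c) = (R_rank s + size c)%N.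
Proof.
elim: c s => [|t c IHc] s /=; first by rewrite addn0.
by case/andP=> /R_edge_rank rk_t /IHc ->; rewrite rk_t addSnnS.
Qed.

Lemma R_le_refl : reflexive R_le.
Proof. exact: connect0. Qed.

Lemma R_le_anti : antisymmetric R_le.
Proof.
move=> s t /andP[/connectP[c sc ->] /connectP[c' tc' def_s]].
have := R_path_rank tc'; rewrite -def_s (R_path_rank sc) -addnA.
by move/eqP; rewrite -[X in X == _]addn0 eqn_add2l eq_sym addn_eq0 => /andP[/nilP->].
Qed.

Lemma R_le_trans : transitive R_le.
Proof. by move=> t s u; apply: connect_trans. Qed.

Fact R_display : Order.disp_t. Proof. exact: (Order.Disp tt tt). Qed.

HB.instance Definition _ :=
  Order.Le_isPOrder.Build R_display R R_le_refl R_le_anti R_le_trans.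

Lemma R_le_edge (t s u : R) : R_edge s t -> t <= u -> s <= u.
Proof. by move/connect1; apply: R_le_trans. Qed.

Lemma R_edge_le (t s u : R) : s <= t -> R_edge t u -> s <= u.
Proof. by move=> st /connect1; apply: R_le_trans. Qed.

Lemma R_le0r (r : R) : R0 <= r.
Proof.
have X i : R_edge R0 i -> R0 <= i by exact: connect1.
have Y i : i \in [:: y1; y2; y3; y4] -> R0 <= i.
  by case: i => // _; [ apply: (@R_edge_le x1) | apply: (@R_edge_le x1)
    | apply: (@R_edge_le x1) | apply: (@R_edge_le x2) ]; rewrite ?X.
have Z i : i \in [:: z1; z2; z3; z4; z5] -> R0 <= i.
  by case: i => // _; [ apply: (@R_edge_le y1) | apply: (@R_edge_le y1)
    | apply: (@R_edge_le y1) | apply: (@R_edge_le y2)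
    | apply: (@R_edge_le y3) ]; rewrite ?Y.
case: r; by [exact: lexx | exact: X | exact: Y | exact: Z
            | exact: (R_edge_le (Z z1 _))].
Qed.

Lemma R_ler1 (r : R) : r <= R1.
Proof.
have Z i : i \in [:: z1; z2; z3; z4; z5] -> i <= R1.
  by case: i => // _; exact: connect1.
have Y i : i \in [:: y1; y2; y3; y4] -> i <= R1.
  by case: i => // _; apply: (@R_le_edge z3); rewrite ?Z.
have X i : i \in [:: x1; x2; x3] -> i <= R1.
  by case: i => // _; apply: (@R_le_edge y3); rewrite ?Y.
case: r; by [exact: lexx | exact: X | exact: Y | exact: Z
            | exact: (@R_le_edge x1 _ _ _ (X x1 _))].
Qed.

HB.instance Definition _ := Order.hasBottom.Build R_display R R_le0r.
HB.instance Definition _ := Order.hasTop.Build R_display R R_ler1.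

Lemma R_lt_rank (s t : R) : s < t -> (R_rank s < R_rank t)%N.
Proof.
rewrite lt_neqAle => /andP[ne_st /connectP[c sc def_t]].
rewrite def_t (R_path_rank sc) -[X in (X < _)%N]addn0 ltn_add2l lt0n.
by apply: contra ne_st => /nilP c0; rewrite def_t c0.
Qed.

Lemma R_coveredE (s t : R) : covered s t = (t \in R_upper_covers s).
Proof.
apply/idP/idP => [/andP[lt_st /forallP no_u]|st].
  case/connectP: (ltW lt_st) => [[|u [|v c]]] /=.
  - by move=> _ eq_ts; rewrite eq_ts ltxx in lt_st.
  - by rewrite andbT => su ->.
  case/and3P=> su uv vc def_t.
  have /negP[] := no_u u; apply/andP; split.
    rewrite lt_neqAle [_ <= _](connect1 su) andbT.
    by apply/eqP => eq_su; have := R_edge_rank su; rewrite eq_su => /n_Sn.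
  rewrite lt_neqAle; apply/andP; split; last first.
    by apply/connectP; exists (v :: c); rewrite //= uv.
  have uc : path R_edge u (v :: c) by rewrite /= uv.
  apply/eqP => eq_ut; have := R_path_rank uc; rewrite /= -def_t -eq_ut.
  by move/eqP; rewrite -[X in X == _]addn0 eqn_add2l.
have rk_t := R_edge_rank st; apply/andP; split.
  rewrite lt_neqAle [_ <= _](connect1 st) andbT.
  by apply/eqP => eq_st; move: rk_t; rewrite eq_st => /n_Sn.
apply/forallP=> u; apply/negP => /andP[/R_lt_rank su /R_lt_rank].
by rewrite rk_t ltnS leqNgt su.
Qed.

Lemma R_graded : graded_of_rank (P := R) 4.
Proof.
move=> c /andP[Rc /eqP last_c].
have Rc' : path R_edge R0 c.
  by rewrite (eq_path (e' := covered)) // => s t; rewrite R_coveredE.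
by have := R_path_rank Rc'; rewrite -[R0]/(\bot : R) last_c.
Qed.

(* Main.v *)
Require Import Defs.
From mathcomp Require Import all_boot all_order.

Set Implicit Arguments.
Unset Strict Implicit.
Unset Printing Implicit Defensive.

Import Order.TTheory.
Local Open Scope order_scope.

(** The proof is an explicit EL-labeling of R by the labels 0, 1, 2, 3, 4,
    given by [R_label] below.

    The labels are chosen so that the increasing maximal chain of [s, t] is the
    greedy one: each step goes to the first available element weakly below t
    in the order x1, x2, x3 at rank 1, y3, y1, y2, y4 at rank 2, and z3, z1,
    z2, z4, z5 at rank 3.  Whenever several steps are available, the greedy one
    has the strictly smallest label, so that the greedy chain is
    lexicographically first.  That it is the only increasing one rests on y3
    covering every x and z3 covering every y.
    - Edges into the top element have label 1, and an edge from some y to some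
      z has label at most 1 exactly when z = z3.  So an increasing chain that
      starts at rank at most 2 and ends at the top element passes through z3.
    - Edges into y3 have label 0, the other edges from some x to some y have a
      positive label, the edge from y3 to z3 has label 1, and the other edges
      into z3 have label 0.  So an increasing chain that starts at rank at most
      1 and ends at z3 passes through y3.
    - The words of the chains from the bottom element to y3 are 00, 20, 40,
      only the first of which increases.  So the increasing chain of the whole
      poset runs through x1, y3, z3 and has the word 0011.
    - In the intervals from the bottom element or some x to some y other than
      y3 or some z other than z3, the remaining labels make the greedy chain
      increase and every other chain descend somewhere.  These intervals have
      few chains; for example the words in [x1, z1] are 34 and 43, and those in
      [x3, z4] are 04, 32 and 32.

    Since R is finite, the labels can be verified by evaluation over all
    intervals ([R_label_rising]).  The evaluation runs over lists of chains; it
    remains to know that these lists contain exactly the maximal chains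
    ([mem_R_chains]) and are nonempty when s <= t ([R_chains_neq0]). *)

Definition R_label (s t : R) : nat :=
  match s, t with
  | R0, x1 => 0 | R0, x2 => 2 | R0, x3 => 4
  | x1, y1 => 3 | x1, y2 => 4 | x1, y3 => 0
  | x2, y1 => 1 | x2, y3 => 0 | x2, y4 => 4
  | x3, y2 => 3 | x3, y3 => 0 | x3, y4 => 3
  | y1, z1 => 4 | y1, z2 => 3 | y1, z3 => 0
  | y2, z1 => 3 | y2, z3 => 0 | y2, z4 => 2
  | y3, z3 => 1 | y3, z4 => 4 | y3, z5 => 2
  | y4, z2 => 3 | y4, z3 => 0 | y4, z4 => 2
  | _, R1 => 1
  | _, _ => 0
  end.

Fixpoint chains_of_size (n : nat) (s t : R) : seq (seq R) :=
  if n is m.+1 then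
    [seq u :: c | u <- R_upper_covers s, c <- chains_of_size m u t]
  else if s == t then [:: [::]] else [::].

Definition R_chains (s t : R) : seq (seq R) :=
  chains_of_size (R_rank t - R_rank s) s t.

Lemma mem_chains_of_size (n : nat) (s t : R) (c : seq R) :
  (c \in chains_of_size n s t) = maximal_chain s t c && (size c == n).
Proof.
rewrite /maximal_chain; elim: n s c => [|n IHn] s [|u c] //=.
- by rewrite andbT; case: (s == t).
- by rewrite andbF; case: (s == t).
- rewrite andbF; apply/negP=> /allpairsPdep[v [c' []]] //.
rewrite eqSS R_coveredE -!andbA (andbA (path _ _ _)) -IHn.
apply/allpairsPdep/andP=> [[v [c' [sv c'P [-> ->]]]] // | [su cP]].
by exists u, c.
Qed.

(** Each step of a maximal chain raises the rank by one, so that the size of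
    the chain is determined by its endpoints. *)
Lemma mem_R_chains (s t : R) (c : seq R) :
  (c \in R_chains s t) = maximal_chain s t c.
Proof.
rewrite mem_chains_of_size andb_idr // => /andP[sc /eqP def_t].
have Rsc : path R_edge s c.
  by rewrite (eq_path (e' := covered)) // => u v; rewrite R_coveredE.
by rewrite -def_t (R_path_rank Rsc) addKn.
Qed.

Lemma R_chains_neq0 (s t : R) : s <= t -> R_chains s t != [::].
Proof.
case/connectP=> c sc def_t; apply/eqP=> no_c.
suff : c \in R_chains s t by rewrite no_c.
rewrite mem_R_chains /maximal_chain def_t eqxx andbT.
by rewrite (eq_path (e' := R_edge)) // => u v; rewrite R_coveredE.
Qed.

Definition rising_in (cs : seq (seq R)) (s : R) (c : seq R) : bool :=
  sorted <=%O (label_word R_label s c) &&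
  all (fun c' =>
         (sorted <=%O (label_word R_label s c') ==> (c == c')) &&
         ((label_word R_label s c : seqlexi nat) <= label_word R_label s c'))
      cs.

(** Pairs with s <= t false have no chains; assuming that the list is nonempty,
    rather than s <= t, leaves a statement that evaluates. *)
Lemma R_label_rising (s t : R) :
  R_chains s t != [::] -> has (rising_in (R_chains s t) s) (R_chains s t).
Proof. by case: s; case: t; vm_compute. Qed.

Theorem claim4p6 : EL_shellable R.
Proof.
exists _, nat, R_label => s t /R_chains_neq0/R_label_rising/hasP[c].
rewrite mem_R_chains => st_c /andP[rise_c /allP c_first].
exists c => [|c']; last by rewrite -mem_R_chains => /c_first/andP[].
split=> // c' [st_c' rise_c'].
by move: st_c'; rewrite -mem_R_chains => /c_first/andP[/implyP/(_ rise_c')/eqP].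
Qed.
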